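(* Let $G_1$ be an $r_1$-regular graph with $r_1\ge 1$, having $n_1$ vertices $v_1,\dots,v_{n_1}$ and $m_1$ edges, and let $G_2$ be an arbitrary graph with $n_2\ge 1$ vertices $w_1,\dots,w_{n_2}$. Let $G_1\diamond G_2$ be the neighborhood corona of $G_1$ and $G_2$, with its vertices ordered as $v_1,\dots,v_{n_1}$, followed by $U_1,U_2,\dots,U_{n_2}$, where $U_j=(w^1_j,w^2_j,\dots,w^{n_1}_j)$. Define $$L_1=L(G_1)+n_2D(G_1),\qquad L_2=-\mathbf{1}^T_{n_2}\otimes A(G_1),\qquad L_3=L(G_2)\otimes I_{n_1}+I_{n_2}\otimes D(G_1),$$ $$S=L_3-J_{n_2\times n_2}\otimes\big[A(G_1)^TL_1^{-1}A(G_1)\big].$$ Then, with respect to this vertex ordering, the matrix $$\begin{pmatrix} L_1^{-1}+L_1^{-1}L_2S^{\#}L_2^TL_1^{-1} & -L_1^{-1}L_2S^{\#}\\ -S^{\#}L_2^TL_1^{-1} & S^{\#}\end{pmatrix}$$ is a symmetric $\{1\}$-inverse of the Laplacian matrix $L(G_1\diamond G_2)$.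
   Context: All graphs are simple and undirected. For a graph $G$, $A(G)$ is its adjacency matrix, $D(G)$ the diagonal matrix of vertex degrees, and $L(G)=D(G)-A(G)$ its Laplacian matrix. The neighborhood corona $G_1\diamond G_2$ of graphs $G_1$ (on $n_1$ vertices) and $G_2$ (on $n_2$ vertices) is the graph obtained by taking one copy of $G_1$ and $n_1$ copies of $G_2$ and joining every neighbor (in $G_1$) of the $i$-th vertex $v_i$ of $G_1$ to every vertex in the $i$-th copy of $G_2$ by a new edge; $w^i_j$ denotes the copy of $w_j$ in the $i$-th copy of $G_2$. $\mathbf{1}_n$ is the all-ones column vector of length $n$, $J_{n\times n}$ the all-ones $n\times n$ matrix, $I_n$ the identity matrix, and $\otimes$ the Kronecker product ($A\otimes B$ is obtained from $A$ by replacing each entry $a_{ij}$ by the block $a_{ij}B$). A matrix $X$ is a $\{1\}$-inverse of $A$ if $AXA=A$. For a square matrix $S$, the group inverse $S^{\#}$ is the unique matrix $X$ with $SXS=S$, $XSX=X$, $SX=XS$ (for real symmetric $S$ it exists and equals the Moore–Penrose inverse). *)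

(* Defs.v *)
From mathcomp Require Import all_boot all_order all_algebra.
From mathcomp Require Export mxtens.

Set Implicit Arguments.
Unset Strict Implicit.
Unset Printing Implicit Defensive.

Import GRing.Theory Num.Theory.
Local Open Scope ring_scope.

Record sgraph (T : finType) := SGraph {
  adj :> rel T;
  adj_sym : symmetric adj;
  adj_irr : irreflexive adj }.

Definition deg (T : finType) (G : sgraph T) (v : T) : nat :=
  #|[set u | G v u]|.

Definition regular (T : finType) (r : nat) (G : sgraph T) : Prop :=
  forall v, deg G v = r.

Definition adjmx (R : pzRingType) (n : nat) (G : sgraph 'I_n) : 'M[R]_n :=
  \matrix_(i, j) (G i j)%:R.

Definition degmx (R : pzRingType) (n : nat) (G : sgraph 'I_n) : 'M[R]_n :=
  diag_mx (\row_i (deg G i)%:R).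

Definition laplmx (R : pzRingType) (n : nat) (G : sgraph 'I_n) : 'M[R]_n :=
  degmx R G - adjmx R G.

(* The vertex [inr (v, w)] is the copy of [w] in the copy of [G2] attached to
   [v]; it is joined to the neighbours of [v] in [G1], but not to [v]. *)
Definition ncorona_rel (T1 T2 : finType) (G1 : sgraph T1) (G2 : sgraph T2) :
    rel (T1 + T1 * T2) := fun x y =>
  match x, y with
  | inl u, inl v => G1 u v
  | inl u, inr (v, _) => G1 v u
  | inr (v, _), inl u => G1 v u
  | inr (v, w), inr (v', w') => (v == v') && G2 w w'
  end.

Lemma ncorona_sym (T1 T2 : finType) (G1 : sgraph T1) (G2 : sgraph T2) :
  symmetric (ncorona_rel G1 G2).
Proof.
case=> [u|[v w]] [u'|[v' w']] //=; first exact: adj_sym.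
by rewrite eq_sym adj_sym.
Qed.

Lemma ncorona_irr (T1 T2 : finType) (G1 : sgraph T1) (G2 : sgraph T2) :
  irreflexive (ncorona_rel G1 G2).
Proof. by case=> [u|[v w]] /=; rewrite adj_irr ?andbF. Qed.

Definition ncorona (T1 T2 : finType) (G1 : sgraph T1) (G2 : sgraph T2) :
    sgraph (T1 + T1 * T2)%type :=
  SGraph (ncorona_sym G1 G2) (ncorona_irr G1 G2).

Section Relabel.
Variables (T : finType) (n : nat) (o : 'I_n -> T) (G : sgraph T).

Let relabel_rel : rel 'I_n := fun i j => G (o i) (o j).

Lemma relabel_sym : symmetric relabel_rel.
Proof. by move=> i j; apply: adj_sym. Qed.

Lemma relabel_irr : irreflexive relabel_rel.
Proof. by move=> i; apply: adj_irr. Qed.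

Definition relabel : sgraph 'I_n := SGraph relabel_sym relabel_irr.
End Relabel.

(* The ordering v_1, ..., v_n1, U_1, ..., U_n2 with U_j = (w^1_j, ..., w^n1_j):
   position n1 + (j * n1 + i) holds w^i_j, i.e. [inr (i, j)]. *)
Definition ncorona_order (n1 n2 : nat) (k : 'I_(n1 + n2 * n1)) :
    'I_n1 + 'I_n1 * 'I_n2 :=
  match split k with
  | inl i => inl i
  | inr l => inr ((mxtens_unindex l).2, (mxtens_unindex l).1)
  end.

Lemma ncorona_order_bij (n1 n2 : nat) : bijective (@ncorona_order n1 n2).
Proof.
exists (fun x => match x with
                 | inl i => lshift (n2 * n1) i
                 | inr (i, j) => rshift n1 (mxtens_index (j, i))
                 end).
- move=> k; rewrite /ncorona_order -{2}[k]splitK; case: (split k) => [//|l].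
  by rewrite -surjective_pairing mxtens_unindexK.
- case=> [i|[i j]]; rewrite /ncorona_order.
    by rewrite (unsplitK (inl i)).
  by rewrite (unsplitK (inr (mxtens_index (j, i)))) mxtens_indexK.
Qed.

Definition inverse1 (R : pzRingType) (m n : nat)
  (A : 'M[R]_(m, n)) (X : 'M[R]_(n, m)) : Prop := A *m X *m A = A.

Definition group_inverse (R : pzRingType) (n : nat) (S X : 'M[R]_n) : Prop :=
  [/\ S *m X *m S = S, X *m S *m X = X & S *m X = X *m S].

Lemma group_inverse_unique (R : pzRingType) (n : nat) (S X Y : 'M[R]_n) :
  group_inverse S X -> group_inverse S Y -> X = Y.
Proof.
case=> SXS XSX cX [SYS YSY cY].
have eXY : S *m X = S *m Y.
  by rewrite -[in RHS]SXS -mulmxA cY cX -mulmxA [S *m (Y *m S)]mulmxA SYS.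
by rewrite -XSX -cX eXY cY -mulmxA eXY mulmxA YSY.
Qed.

(* Main.v *)
Require Import Defs.
From mathcomp Require Import all_boot all_order all_algebra.
From mathcomp Require Import ring.

(** In the given vertex ordering the Laplacian of the corona is the block matrix
    (L1, L2; L2^T, L3).  L1 is positive definite, being the Laplacian of G1 plus
    n2 r1 times the identity, and S is the Schur complement L3 - L2^T L1^-1 L2.
    The Laplacian factors as P diag(L1, S) P^T with P unitriangular, so inverting
    P and L1 and taking a {1}-inverse of S yields a {1}-inverse of it.  A real symmetric S satisfies
    ker S^2 = ker S, so it has a symmetric group inverse. *)

Set Implicit Arguments.
Unset Strict Implicit.
Unset Printing Implicit Defensive.

Import Order.TTheory GRing.Theory Num.Theory.
Local Open Scope ring_scope.

(** * Quadratic forms and group inverses of real symmetric matrices *)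

Section RealMatrices.
Variable R : realFieldType.

Lemma mulmx_tr_self_eq0 n (x : 'rV[R]_n) : (x *m x^T) 0 0 = 0 -> x = 0.
Proof.
rewrite mxE => /eqP; rewrite psumr_eq0 => [/allP x0|i _]; last first.
  by rewrite mxE -expr2 sqr_ge0.
apply/rowP => i; have := x0 i (mem_index_enum i).
by rewrite !mxE -expr2 sqrf_eq0 => /eqP.
Qed.

Lemma mulmx_tr_self_ge0 n (x : 'rV[R]_n) : 0 <= (x *m x^T) 0 0.
Proof. by rewrite mxE sumr_ge0 // => i _; rewrite mxE -expr2 sqr_ge0. Qed.

Lemma unitmx_quadratic n (A : 'M[R]_n) :
  (forall x : 'rV_n, (x *m A *m x^T) 0 0 = 0 -> x = 0) -> A \in unitmx.
Proof.
move=> A0; rewrite -row_free_unit; apply: inj_row_free => x xA.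
by apply: A0; rewrite xA mul0mx mxE.
Qed.

(** If [u S^2 = 0], then [u S] has squared norm [u S^2 u^T = 0], so [u S = 0]. The kernels of [S]
    and [S^2] thus agree, hence so do the ranks and, by inclusion, the row spaces. *)
Lemma symmetric_submx_sqr n (S : 'M[R]_n) : S^T = S -> (S <= S *m S)%MS.
Proof.
move=> symS.
have kS : (kermx (S *m S) <= kermx S)%MS.
  apply/rV_subP => u /sub_kermxP uSS; apply/sub_kermxP/mulmx_tr_self_eq0.
  by rewrite trmx_mul symS mulmxA -[u *m S *m S]mulmxA uSS mul0mx mxE.
have := mxrankS kS; rewrite !mxrank_ker => le_rank.
rewrite -(geq_leqif (mxrank_leqif_sup (submxMl S S))).
by move: le_rank; rewrite leq_sub2lE ?rank_leq_row.
Qed.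

(* If S = W S^2 with S symmetric, then S = S^2 W^T and W S W^T is the group
   inverse of S. *)
Lemma symmetric_group_inverse n (S : 'M[R]_n) : S^T = S ->
  exists2 X : 'M[R]_n, group_inverse S X & X^T = X.
Proof.
move=> symS; have /submxP[W SW] := symmetric_submx_sqr symS.
have SZ : S = S *m S *m W^T.
  by rewrite -[LHS]symS [in LHS]SW !trmx_mul symS.
(* Both sides equal [W S^2 W^T]. They turn out to be [S X] and [X S], which gives the
   commutation. *)
have WZ : S *m W^T = W *m S.
  by rewrite [in LHS]SW -!mulmxA [S *m (S *m _)]mulmxA -SZ.
exists (W *m S *m W^T); last by rewrite !trmx_mul trmxK symS mulmxA.
have SX : S *m (W *m S *m W^T) = S *m W^T.
  by rewrite -WZ !mulmxA -SZ.
have XS : W *m S *m W^T *m S = W *m S.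
  by rewrite -[W *m S *m _]mulmxA WZ -!mulmxA -SW.
split; first by rewrite SX WZ -mulmxA -SW.
  by rewrite XS -[LHS]mulmxA SX mulmxA.
by rewrite SX XS.
Qed.

End RealMatrices.

(** * {1}-inverses by the Schur complement *)

Section SchurComplement.
Variables (R : comUnitRingType) (m n : nat).
Variables (A : 'M[R]_m) (B : 'M[R]_(m, n)) (C : 'M[R]_(n, m)) (D : 'M[R]_n).
Variable X : 'M[R]_n.

Let N : 'M[R]_(m + n) :=
  block_mx (invmx A + invmx A *m B *m X *m C *m invmx A) (- (invmx A *m B *m X))
           (- (X *m C *m invmx A)) X.

Lemma schur_inverse1 : A \in unitmx ->
  inverse1 (D - C *m invmx A *m B) X -> inverse1 (block_mx A B C D) N.
Proof.
rewrite /inverse1; set S := D - _ => uA SXS.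
have defD : D = S + C *m invmx A *m B by rewrite subrK.
(* With [D] rewritten through [S], the top row of the product becomes [(1, 0)]. Only the bottom row
   is left to check, and there [S X S = S] restores [D]. *)
have LN : block_mx A B C D *m N =
    block_mx 1%:M 0 (C *m invmx A - S *m X *m C *m invmx A) (S *m X).
  rewrite mulmx_block defD; congr block_mx.
  - by rewrite mulmxDr !mulmxA !mulmxN !mulmxA mulmxV // mul1mx addrK.
  - by rewrite mulmxN !mulmxA mulmxV // mul1mx addNr.
  - by rewrite mulmxDr mulmxN !mulmxDl !mulmxA opprD addrACA subrr addr0.
  - by rewrite mulmxN mulmxDl !mulmxA addrCA addNr addr0.
rewrite LN mulmx_block; congr block_mx.
- by rewrite mul1mx mul0mx addr0.
- by rewrite mul1mx mul0mx addr0.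
- by rewrite mulmxBl -!mulmxA mulVmx // !mulmx1 subrK.
- rewrite [in S *m X *m D]defD mulmxDr SXS mulmxBl !mulmxA.
  by rewrite addrA addrAC subrK addrC.
Qed.

Lemma schur_inverse1_sym : A^T = A -> C = B^T -> X^T = X -> N^T = N.
Proof.
move=> symA defC symX; rewrite /N defC tr_block_mx raddfD /= ![(- _)^T]raddfN /=.
by rewrite !trmx_mul !trmxK trmx_inv symA symX !mulmxA.
Qed.

End SchurComplement.

(** * Positivity of the Laplacian *)

Section Laplacian.
Variable R : realFieldType.

Lemma degE (T : finType) (G : sgraph T) v : deg G v = (\sum_u G v u)%N.
Proof. by rewrite /deg cardsE -sum1_card big_mkcond. Qed.

Lemma adjmx_sym n (G : sgraph 'I_n) : (adjmx R G)^T = adjmx R G.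
Proof. by apply/matrixP => i j; rewrite !mxE adj_sym. Qed.

Lemma laplmx_sym n (G : sgraph 'I_n) : (laplmx R G)^T = laplmx R G.
Proof. by rewrite /laplmx linearB /= adjmx_sym tr_diag_mx. Qed.

(** The sum runs over ordered pairs, so every edge is counted twice; this accounts for the factor 2
    and avoids choosing orientations. *)
Lemma laplmx_quadratic n (G : sgraph 'I_n) (x : 'rV[R]_n) :
  (x *m laplmx R G *m x^T) 0 0 *+ 2 =
  \sum_i \sum_j (G i j)%:R * (x 0 i - x 0 j) ^+ 2.
Proof.
have sq i j : (G i j)%:R * (x 0 i - x 0 j) ^+ 2 =
    ((G i j)%:R * x 0 i ^+ 2 + (G i j)%:R * x 0 j ^+ 2)
      - ((G i j)%:R * x 0 i * x 0 j) *+ 2 by ring.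
under [RHS]eq_bigr => i _ do
  (under eq_bigr => j _ do rewrite sq; rewrite sumrB big_split).
(* Swapping the indices and using the symmetry of [G] identifies the two sums of squares; each is
   the degree part of the form. *)
rewrite sumrB big_split /= [X in _ + X - _]exchange_big /=.
under [X in _ + X - _]eq_bigr => j _ do
  under eq_bigr => i _ do rewrite adj_sym.
rewrite -mulr2n.
under [X in _ - X]eq_bigr do rewrite sumrMnl.
rewrite sumrMnl -mulrnBl; congr (_ *+ 2).
rewrite mulmxBr mulmxBl mxE [X in _ + X]mxE; congr (_ - _).
  rewrite mxE; apply: eq_bigr => i _.
  rewrite mul_mx_diag !mxE -mulr_suml degE natr_sum.
  by rewrite mulrAC -expr2 mulrC.
rewrite -mulmxA mxE; apply: eq_bigr => i _.
rewrite mxE mulr_sumr; apply: eq_bigr => j _.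
by rewrite !mxE; ring.
Qed.

Lemma laplmx_psd n (G : sgraph 'I_n) (x : 'rV[R]_n) :
  0 <= (x *m laplmx R G *m x^T) 0 0.
Proof.
rewrite -(@pmulrn_lge0 _ _ 2) // laplmx_quadratic.
by do 2![apply: sumr_ge0 => ? _]; rewrite mulr_ge0 ?ler0n ?sqr_ge0.
Qed.

Lemma regular_degmx n r (G : sgraph 'I_n) :
  regular r G -> degmx R G = r%:R%:M.
Proof.
move=> rG; rewrite /degmx -diag_const_mx; congr diag_mx.
by apply/rowP => i; rewrite !mxE rG.
Qed.

(** The form is a sum of two nonnegative terms, one of them [c] times the squared norm of [x], so it
    vanishes only at [x = 0]. *)
Lemma laplmx_add_scalar_unit n (G : sgraph 'I_n) (c : R) :
  0 < c -> laplmx R G + c%:M \in unitmx.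
Proof.
move=> c0; apply: unitmx_quadratic => x.
rewrite mulmxDr mulmxDl mul_mx_scalar -scalemxAl mxE [X in _ + X]mxE => /eqP.
have xx := mulmx_tr_self_ge0 x.
rewrite paddr_eq0 ?laplmx_psd ?mulr_ge0 ?(ltW c0) // => /andP[_].
by rewrite mulf_eq0 (gt_eqF c0) => /eqP /mulmx_tr_self_eq0.
Qed.

End Laplacian.

(** * Degrees and block Laplacian of the corona *)

Section NeighborhoodCorona.
Variables (n1 n2 : nat) (G1 : sgraph 'I_n1) (G2 : sgraph 'I_n2).

Lemma deg_relabel (T : finType) n (o : 'I_n -> T) (G : sgraph T) i :
  bijective o -> deg (relabel o G) i = deg G (o i).
Proof.
by move=> bij_o; rewrite !degE [RHS](reindex o) //; apply: onW_bij.
Qed.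

(** Each neighbour of [u] in [G1] contributes itself and the [n2] vertices of its copy of [G2]. *)
Lemma deg_ncorona_inl u : deg (ncorona G1 G2) (inl u) = (deg G1 u * n2.+1)%N.
Proof.
rewrite !degE big_sumType /= mulnS; congr (_ + _)%N.
transitivity (\sum_(p : 'I_n1 * 'I_n2) nat_of_bool (G1 p.1 u))%N.
  by apply: eq_bigr => -[].
rewrite -(pair_bigA _ (fun v (w : 'I_n2) => nat_of_bool (G1 v u))) /=.
rewrite big_distrl /=; apply: eq_bigr => v _.
by rewrite sum_nat_const card_ord mulnC adj_sym.
Qed.

Lemma deg_ncorona_inr v w :
  deg (ncorona G1 G2) (inr (v, w)) = (deg G2 w + deg G1 v)%N.
Proof.
rewrite !degE big_sumType /= addnC; congr (_ + _)%N.
transitivity (\sum_(p : 'I_n1 * 'I_n2)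
    nat_of_bool ((v == p.1) && G2 w p.2))%N.
  by apply: eq_bigr => -[].
rewrite -(pair_bigA _ (fun v' w' => nat_of_bool ((v == v') && G2 w w'))) /=.
rewrite (bigD1 v) //= eqxx [X in (_ + X)%N]big1 ?addn0 // => v'.
by rewrite eq_sym => /negbTE ->; rewrite big1.
Qed.

Lemma ncorona_order_lshift i : @ncorona_order n1 n2 (lshift _ i) = inl i.
Proof. by rewrite /ncorona_order (unsplitK (inl i)). Qed.

Lemma ncorona_order_rshift k :
  @ncorona_order n1 n2 (rshift _ k) =
  inr ((mxtens_unindex k).2, (mxtens_unindex k).1).
Proof. by rewrite /ncorona_order (unsplitK (inr k)). Qed.

Variable R : realFieldType.

(** Both sides are [n2] copies of the adjacency matrix side by side: the second coordinate of a
    column index is its vertex of [G1]. The [colsub] form does away with the cast from [1 * n1]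
    rows. *)
Lemma ones_tens_colsub :
  castmx (mul1n n1, erefl (n2 * n1)%N)
    ((const_mx 1 : 'cV[R]_n2)^T *t adjmx R G1) =
  colsub (fun l => (mxtens_unindex l).2) (adjmx R G1).
Proof.
apply/matrixP => i l; rewrite castmxE !mxE mul1r cast_ord_id.
by congr (G1 _ _)%:R; apply: val_inj => /=; rewrite modn_small.
Qed.

Lemma laplmx_ncorona :
  laplmx R (relabel (@ncorona_order n1 n2) (ncorona G1 G2)) =
  block_mx (laplmx R G1 + n2%:R *: degmx R G1)
    (- colsub (fun l => (mxtens_unindex l).2) (adjmx R G1))
    (- colsub (fun l => (mxtens_unindex l).2) (adjmx R G1))^T
    ((laplmx R G2 *t (1%:M : 'M[R]_n1)) +
     ((1%:M : 'M[R]_n2) *t degmx R G1)).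
Proof.
have bij_o := ncorona_order_bij n1 n2.
rewrite -[LHS]submxK; congr block_mx; apply/matrixP => i j; rewrite !mxE.
- rewrite deg_relabel // /= !ncorona_order_lshift deg_ncorona_inl /=.
  rewrite (inj_eq (@lshift_inj _ _)) natrM -natr1.
  by case: (i == j); rewrite ?mulr1n ?mulr0n; ring.
- rewrite deg_relabel // eq_lrshift /= ncorona_order_lshift ncorona_order_rshift.
  by rewrite /= mulr0n sub0r adj_sym.
- rewrite deg_relabel // eq_rlshift /= ncorona_order_lshift ncorona_order_rshift.
  by rewrite /= mulr0n sub0r adj_sym.
- rewrite deg_relabel // /= !ncorona_order_rshift deg_ncorona_inr /=.
  rewrite (inj_eq (@rshift_inj _ _)) natrD.
  (* Equality of positions becomes equality of both coordinates. Once these are generalized, the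
     entries agree for all truth values of the two equalities and of the adjacency in [G2]. *)
  rewrite -(inj_eq (can_inj (@mxtens_unindexK n2 n1))).
  rewrite xpair_eqE /=.
  move: (Ordinal (mxtens_index_proof1 i)) (Ordinal (mxtens_index_proof1 j)).
  move: (Ordinal (mxtens_index_proof2 i)) (Ordinal (mxtens_index_proof2 j)).
  move=> v v' w w'; case: (v == v'); case: (w == w'); case: (G2 w w');
    rewrite /= ?mulr1n ?mulr0n; ring.
Qed.

End NeighborhoodCorona.

Theorem theorem3p2 (R : realFieldType) (n1 n2 r1 : nat)
    (G1 : sgraph 'I_n1) (G2 : sgraph 'I_n2)
    (hr1 : (1 <= r1)%N) (hG1 : regular r1 G1) (hn2 : (1 <= n2)%N) :
  let A1 := adjmx R G1 in
  let D1 := degmx R G1 in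
  let L1 : 'M[R]_n1 := laplmx R G1 + n2%:R *: D1 in
  let L2 : 'M[R]_(n1, n2 * n1) :=
    - castmx (mul1n n1, erefl (n2 * n1)%N)
        ((const_mx 1 : 'cV[R]_n2)^T *t A1) in
  let L3 : 'M[R]_(n2 * n1) :=
    (laplmx R G2 *t (1%:M : 'M[R]_n1)) + ((1%:M : 'M[R]_n2) *t D1) in
  let S : 'M[R]_(n2 * n1) :=
    L3 - ((const_mx 1 : 'M[R]_n2) *t (A1^T *m invmx L1 *m A1)) in
  L1 \in unitmx /\
  exists2 Sg : 'M[R]_(n2 * n1), group_inverse S Sg &
    let N : 'M[R]_(n1 + n2 * n1) :=
      block_mx
        (invmx L1 + invmx L1 *m L2 *m Sg *m L2^T *m invmx L1)
        (- (invmx L1 *m L2 *m Sg))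
        (- (Sg *m L2^T *m invmx L1))
        Sg in
    N^T = N /\
    inverse1 (laplmx R (relabel (@ncorona_order n1 n2) (ncorona G1 G2))) N.
Proof.
move=> A1 D1 L1 L2 L3 S.
have defD : D1 = r1%:R%:M := regular_degmx R hG1.
(* By regularity [L1] is the Laplacian of [G1] plus the scalar [n2 * r1], which is positive as both
   factors are. *)
have uL1 : L1 \in unitmx.
  rewrite /L1 defD scale_scalar_mx laplmx_add_scalar_unit //.
  by rewrite mulr_gt0 // ltr0n.
have symL1 : L1^T = L1.
  by rewrite /L1 raddfD /= laplmx_sym defD scale_scalar_mx tr_scalar_mx.
have symP : (invmx L1)^T = invmx L1 by rewrite trmx_inv symL1.
have symL3 : L3^T = L3.
  by rewrite /L3 raddfD /= !trmx_tens laplmx_sym defD !tr_scalar_mx.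
have defL2 : L2 = - colsub (fun l => (mxtens_unindex l).2) A1.
  by rewrite /L2 ones_tens_colsub.
(* The two signs of [L2] cancel, and repeating the columns of [A1] on both sides tiles
   [A1^T L1^-1 A1] into [n2 * n2] equal blocks, its tensor product with the all-ones matrix. *)
have defS : S = L3 - L2^T *m invmx L1 *m L2.
  rewrite /S defL2; congr (_ - _).
  rewrite [(- _)^T]raddfN /= mulmxN !mulNmx opprK.
  rewrite mulmx_colsub trmx_mxsub !mul_rowsub_mx.
  by apply/matrixP => k l; rewrite !mxE mul1r.
have symS : S^T = S.
  by rewrite defS raddfB /= !trmx_mul trmxK symP symL3 mulmxA.
split=> //; have [X SX symX] := symmetric_group_inverse symS.
exists X => // N; split; first exact: schur_inverse1_sym.
rewrite laplmx_ncorona -defL2; apply: schur_inverse1 => //.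
by rewrite /inverse1 -/L3 -defS; case: SX.
Qed.
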